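(* Let $\lambda$ be a nonzero cardinal, $S$ a monoid and $\theta\colon S\to H_S(1_S)$ a homomorphism. The semigroup $\mathscr{P}_\lambda(\theta,S)$ is inverse if and only if the semigroup $S$ is inverse.
   Context: For a nonzero cardinal $\lambda$, $\lambda^*$ is the free monoid over the alphabet $\lambda$, $\varepsilon$ is the empty word and $|a|$ is the length of a word $a$. The $\lambda$-polycyclic monoid $P_\lambda$ is the semigroup with zero $0$ and identity $1$ generated by $\{p_i\}_{i\in\lambda}\cup\{p_i^{-1}\}_{i\in\lambda}$ subject to $p_ip_i^{-1}=1$ and $p_ip_j^{-1}=0$ for $i\ne j$ (for $\lambda=1$ it is the bicyclic monoid with adjoined zero). Identifying words of $\lambda^*$ with products of the $p_i$, each nonzero element of $P_\lambda$ is uniquely of the form $a^{-1}b$ with $a,b\in\lambda^*$. For a monoid $S$ with identity $1_S$, $H_S(1_S)$ is its group of units. Given a homomorphism $\theta\colon S\to H_S(1_S)$, put $\theta^0(s)=s$ and $\theta^n=\theta\circ\cdots\circ\theta$ ($n$ times). The Bruck–Reilly $\lambda$-polycyclic extension is the set $\mathscr{P}_\lambda(\theta,S)=(S\times(P_\lambda\setminus\{0\}))\sqcup\{\boldsymbol{0}\}$ with the associative operation $*$ for which $\boldsymbol{0}$ is a zero and $$(s,a_1^{-1}a_2)*(t,b_1^{-1}b_2)=\begin{cases}(\theta^{|u|}(s)t,(ua_1)^{-1}b_2), & \text{if } b_1=ua_2 \text{ for some } u\in\lambda^*,\\ (s\theta^{|v|}(t),a_1^{-1}vb_2), & \text{if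 } a_2=vb_1 \text{ for some } v\in\lambda^*,\\ \boldsymbol{0}, & \text{otherwise.}\end{cases}$$ *)

(* Defs.v *)
From HB Require Import structures.
From mathcomp Require Import all_boot.
From mathcomp Require Import boolp.

Set Implicit Arguments.
Unset Strict Implicit.
Unset Printing Implicit Defensive.

Local Open Scope group_scope.

Definition inverse_semigroup (T : semigroupType) : Prop :=
  forall x : T, exists! y : T, x * y * x = x /\ y * x * y = y.

(** * The group of units of a monoid *)

Section Units.
Variable S : monoidType.

Definition is_unit : pred S :=
  fun x => `[< exists y, x * y = 1 /\ y * x = 1 >].

Record unit_group := UnitGroup { unit_val : S; _ : is_unit unit_val }.

HB.instance Definition _ := [isSub for unit_val].
HB.instance Definition _ := [Choice of unit_group by <:].

Lemma is_unit_closed : umagma_closed is_unit.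
Proof.
split; first by apply/asboolP; exists 1; rewrite mul1g.
move=> x y /asboolP [x' [xx' x'x]] /asboolP [y' [yy' y'y]].
apply/asboolP; exists (y' * x'); split.
  by rewrite mulgA -(mulgA x) yy' mulg1.
by rewrite mulgA -(mulgA y') x'x mulg1.
Qed.

HB.instance Definition _ :=
  SubChoice_isSubMonoid.Build S is_unit unit_group is_unit_closed.

Lemma unit_has_inverse (x : unit_group) :
  exists y : unit_group, x * y = 1 /\ y * x = 1.
Proof.
case/asboolP: (valP x) => y [xy yx].
have uy : is_unit y by apply/asboolP; exists (val x).
by exists (UnitGroup uy); split; apply: val_inj.
Qed.

Definition unit_inv (x : unit_group) : unit_group :=
  sval (cid (unit_has_inverse x)).

HB.instance Definition _ := hasInv.Build unit_group unit_inv.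

Lemma unit_mulVg : left_inverse 1 (@inv unit_group) *%g.
Proof. by move=> x; rewrite /inv /= /unit_inv; case: cid => y []. Qed.

Lemma unit_mulgV : right_inverse 1 (@inv unit_group) *%g.
Proof. by move=> x; rewrite /inv /= /unit_inv; case: cid => y []. Qed.

HB.instance Definition _ :=
  Monoid_isGroup.Build unit_group unit_mulVg unit_mulgV.

End Units.

(** * Words *)

Section Words.
Variable lambda : Type.
Implicit Types a b c u v : seq lambda.

Lemma cat_injr a b c : a ++ c = b ++ c -> a = b.
Proof.
move=> e; have es : size a = size b.
  by apply/eqP; rewrite -(eqn_add2r (size c)) -!size_cat e.
by rewrite -(take_size_cat c (erefl (size a))) e es take_size_cat.
Qed.

Definition word_comparable a b : Prop :=
  (exists u, b = u ++ a) \/ (exists v, a = v ++ b).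

Lemma cat_comparable u v a b : u ++ a = v ++ b -> word_comparable a b.
Proof.
elim: u v => [|x u IHu] [|y v] /=; first by move=> ->; left; exists nil.
- by move=> ->; right; exists (y :: v).
- by move=> <-; left; exists (x :: u).
- by case=> _ /IHu.
Qed.

Lemma word_comparableC a b : word_comparable a b -> word_comparable b a.
Proof. by case; [right|left]. Qed.

Lemma word_comparable_catl v a b :
  word_comparable (v ++ a) b -> word_comparable a b.
Proof.
case=> [[u ->]|[u]]; last exact: cat_comparable.
by left; exists (u ++ v); rewrite catA.
Qed.

Lemma word_comparable_cat2r c a b :
  word_comparable (a ++ c) (b ++ c) -> word_comparable a b.
Proof.
by case=> [[u]|[u]]; rewrite catA => /cat_injr ->; [left|right]; exists u.
Qed.

Lemma word_incomparable a b : ~ word_comparable a b ->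
  exists a' b' c i j, [/\ i <> j, a = a' ++ i :: c & b = b' ++ j :: c].
Proof.
elim/last_ind: a b => [|a i IHa] b.
  by case; left; exists b; rewrite cats0.
elim/last_ind: b => [|b j _].
  by case; right; exists (rcons a i); rewrite cats0.
rewrite -!cats1 => nab.
have [ij|nij] := pselect (i = j); last by exists a, b, nil, i, j.
case: (IHa b) => [|a' [b' [c [k [l [nkl ea eb]]]]]].
  rewrite ij in nab; case=> [[u e]|[u e]]; apply: nab.
    by left; exists u; rewrite e catA.
  by right; exists u; rewrite e catA.
by exists a', b', (c ++ [:: i]), k, l; split=> //; rewrite ?ea ?eb ?ij -catA.
Qed.

End Words.

(** * The polycyclic monoid *)

(* A cardinal is given by a type lambda of that cardinality, and words over
   lambda are sequences.  [PCWord a b] stands for the nonzero element a^{-1} b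
   of P_lambda, so that [pcword lambda] is P_lambda without its zero. *)
Record pcword (lambda : Type) := PCWord { pcl : seq lambda; pcr : seq lambda }.

Section Polycyclic.
Variable lambda : Type.

(* [None] is the zero. *)
Definition polycyclic : Type := option (pcword lambda).

Definition polycyclic_mul (x y : polycyclic) : polycyclic :=
  match x, y with
  | Some (PCWord a1 a2), Some (PCWord b1 b2) =>
      match pselect (exists u, b1 = u ++ a2) with
      | left e => Some (PCWord (sval (cid e) ++ a1) b2)
      | right _ =>
          match pselect (exists v, a2 = v ++ b1) with
          | left e => Some (PCWord a1 (sval (cid e) ++ b2))
          | right _ => None
          end
      end
  | _, _ => None
  end.

Definition pc_zero : polycyclic := None.
Definition pc_one : polycyclic := Some (PCWord nil nil).
Definition pc_gen (i : lambda) : polycyclic := Some (PCWord nil [:: i]).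
Definition pc_gen_inv (i : lambda) : polycyclic := Some (PCWord [:: i] nil).

Lemma polycyclic_mull a1 a2 u b2 :
  polycyclic_mul (Some (PCWord a1 a2)) (Some (PCWord (u ++ a2) b2)) =
  Some (PCWord (u ++ a1) b2).
Proof.
rewrite /polycyclic_mul; case: pselect => [e|[]]; last by exists u.
by case: (cid e) => w /= /cat_injr <-.
Qed.

Lemma polycyclic_mulr a1 v b1 b2 :
  polycyclic_mul (Some (PCWord a1 (v ++ b1))) (Some (PCWord b1 b2)) =
  Some (PCWord a1 (v ++ b2)).
Proof.
rewrite /polycyclic_mul; case: pselect => [e|_].
  case: (cid e) => w /= e1; have /eqP := congr1 size e1.
  rewrite !size_cat addnA -{1}(add0n (size b1)) eqn_add2r eq_sym addn_eq0.
  by case/andP=> /nilP -> /nilP ->.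
case: pselect => [e|[]]; last by exists v.
by case: (cid e) => w /= /cat_injr <-.
Qed.

Lemma polycyclic_mul0 a1 a2 b1 b2 : ~ word_comparable a2 b1 ->
  polycyclic_mul (Some (PCWord a1 a2)) (Some (PCWord b1 b2)) = None.
Proof.
move=> n; rewrite /polycyclic_mul.
case: pselect => [e|_]; first by case: n; left.
by case: pselect => [e|_] //; case: n; right.
Qed.

Lemma polycyclic_mulA : associative polycyclic_mul.
Proof.
have mul_None x : polycyclic_mul x None = None by case: x => [[]|].
move=> [[a1 a2]|//] [[b1 b2]|//] [[c1 c2]|]; last by rewrite !mul_None.
case: (pselect (word_comparable a2 b1)) => [[[u ->]|[v ->]]|n1];
  case: (pselect (word_comparable b2 c1)) => [[[w ->]|[w ->]]|n2].
- by rewrite !polycyclic_mull (catA w u a2) polycyclic_mull catA.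
- by rewrite polycyclic_mull !polycyclic_mulr polycyclic_mull.
- by rewrite polycyclic_mull !polycyclic_mul0.
- rewrite polycyclic_mull polycyclic_mulr.
  case: (pselect (word_comparable v w)) => [[[k ->]|[k ->]]|n].
  + by rewrite -!catA !polycyclic_mull.
  + by rewrite -!catA !polycyclic_mulr.
  + by rewrite !polycyclic_mul0 // => /word_comparable_cat2r.
- by rewrite !polycyclic_mulr (catA v w c1) polycyclic_mulr catA.
- rewrite polycyclic_mulr !polycyclic_mul0 //.
  by move/word_comparable_catl.
- rewrite polycyclic_mull !polycyclic_mul0 //.
  by move/word_comparableC/word_comparable_catl/word_comparableC.
- by rewrite polycyclic_mulr !polycyclic_mul0.
- by rewrite !polycyclic_mul0.
Qed.

Lemma polycyclic_mul1x : left_id pc_one polycyclic_mul.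
Proof.
case=> [[a b]|//]; rewrite /pc_one -{1}(cats0 a).
by rewrite polycyclic_mull cats0.
Qed.

Lemma polycyclic_mulx1 : right_id pc_one polycyclic_mul.
Proof.
case=> [[a b]|//]; rewrite /pc_one -{1}(cats0 b).
by rewrite polycyclic_mulr cats0.
Qed.

HB.instance Definition _ := gen_eqMixin polycyclic.
HB.instance Definition _ := gen_choiceMixin polycyclic.
HB.instance Definition _ := isMonoid.Build polycyclic
  polycyclic_mulA polycyclic_mul1x polycyclic_mulx1.

Lemma polycyclic_normal_form a b :
  Some (PCWord a b) =
  (\prod_(i <- rev a) pc_gen_inv i) * (\prod_(i <- b) pc_gen i) :> polycyclic.
Proof.
have -> : \prod_(i <- b) pc_gen i = Some (PCWord nil b) :> polycyclic.
  elim: b => [|i b IHb]; first by rewrite big_nil.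
  by rewrite big_cons IHb; apply: (@polycyclic_mulr nil [:: i] nil b).
have -> : \prod_(i <- rev a) pc_gen_inv i = Some (PCWord a nil) :> polycyclic.
  elim: a => [|i a IHa]; first by rewrite big_nil.
  rewrite rev_cons -cats1 big_cat big_seq1 IHa /=.
  exact: (@polycyclic_mull a nil [:: i] nil).
by have := @polycyclic_mull a nil nil b.
Qed.

(* [polycyclic] is the monoid with zero generated by the p_i and p_i^{-1}
   subject to p_i p_i^{-1} = 1 and p_i p_j^{-1} = 0 for i <> j. *)
Lemma pc_gen_mulV i : pc_gen i * pc_gen_inv i = 1 :> polycyclic.
Proof. exact: (@polycyclic_mull nil [:: i] nil nil). Qed.

Lemma pc_gen_mul0 i j : i <> j -> pc_gen i * pc_gen_inv j = pc_zero.
Proof.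
move=> nij; apply: polycyclic_mul0.
by case=> [[[|? [|? ?]] []]|[[|? [|? ?]] []]] // e; case: nij.
Qed.

Lemma polycyclic_presentation (M : monoidType) (z : M) (p q : lambda -> M) :
  (forall x, z * x = z /\ x * z = z) ->
  (forall i, p i * q i = 1) -> (forall i j, i <> j -> p i * q j = z) ->
  exists! f : polycyclic -> M,
    [/\ monoid_morphism f, f pc_zero = z,
        forall i, f (pc_gen i) = p i & forall i, f (pc_gen_inv i) = q i].
Proof.
move=> zP pq1 pq0.
pose P (b : seq lambda) := \prod_(i <- b) p i.
pose Q (a : seq lambda) := \prod_(i <- rev a) q i.
have PD u v : P (u ++ v) = P u * P v by rewrite /P big_cat.
have QD u v : Q (u ++ v) = Q v * Q u by rewrite /Q rev_cat big_cat.
have P1 i : P [:: i] = p i by rewrite /P big_seq1.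
have Q1 i : Q [:: i] = q i by rewrite /Q big_seq1.
have P0 : P nil = 1 by rewrite /P big_nil.
have Q0 : Q nil = 1 by rewrite /Q big_nil.
have PQ u : P u * Q u = 1.
  elim/last_ind: u => [|u i IHu]; first by rewrite P0 Q0 mulg1.
  by rewrite -cats1 PD QD P1 Q1 mulgA -(mulgA (P u)) pq1 mulg1.
pose f (x : polycyclic) := if x is Some (PCWord a b) then Q a * P b else z.
exists f; split=> [|g [[g1 gM] gz gp gq]].
  split=> // [|i|i]; last 2 first.
  - by rewrite /f /= Q0 P1 mul1g.
  - by rewrite /f /= P0 Q1 mulg1.
  split; first by rewrite /f /= Q0 P0 mulg1.
  case=> [[a1 a2]|] y; last by rewrite /= (zP _).1.
  case: y => [[b1 b2]|]; last by rewrite /= (zP _).2.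
  case: (pselect (word_comparable a2 b1)) => [[[u ->]|[v ->]]|n].
  - rewrite [_ * _]polycyclic_mull /= !QD.
    by rewrite -!mulgA (mulgA (P a2)) PQ mul1g.
  - rewrite [_ * _]polycyclic_mulr /= !PD.
    by rewrite -!mulgA (mulgA (P b1)) PQ mul1g.
  - rewrite [_ * _]polycyclic_mul0 //=.
    have [a' [b' [c [i [j [nij -> ->]]]]]] := word_incomparable n.
    rewrite -(cat1s i) -(cat1s j) !PD !QD P1 Q1 -!mulgA (mulgA (P c)) PQ.
    by rewrite mul1g (mulgA (p i)) pq0 // (zP _).1 !(zP _).2.
apply/funext => -[[a b]|] /=; last by rewrite gz.
by rewrite polycyclic_normal_form gM !(big_morph g gM g1)
  (eq_bigr _ (fun i _ => gp i)) (eq_bigr _ (fun i _ => gq i)).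
Qed.

End Polycyclic.

(** * Bruck-Reilly extensions *)

(* [None] is the zero.  The carrier does not depend on theta, but the type
   mentions it so that the product can be inferred from the type. *)
Definition bruck_reilly (lambda : Type) (S : monoidType)
    (theta : {multiplicative S -> unit_group S}) : Type :=
  option (S * pcword lambda).
Arguments bruck_reilly lambda {S} theta.

Section BruckReilly.
Variables (lambda : Type) (S : monoidType).
Variable theta : {multiplicative S -> unit_group S}.

Definition theta_iter (n : nat) (s : S) : S :=
  iter n (fun x => val (theta x)) s.

Local Notation bruck_reilly := (bruck_reilly lambda theta).

(* The word u (resp. v) extracted by [cid] is unique, and the first two cases
   agree when they overlap, that is when a2 = b1. *)
Definition bruck_reilly_mul (x y : bruck_reilly) : bruck_reilly :=
  match x, y with
  | Some (s, PCWord a1 a2), Some (t, PCWord b1 b2) =>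
      match pselect (exists u, b1 = u ++ a2) with
      | left e =>
          let u := sval (cid e) in
          Some (theta_iter (size u) s * t, PCWord (u ++ a1) b2)
      | right _ =>
          match pselect (exists v, a2 = v ++ b1) with
          | left e =>
              let v := sval (cid e) in
              Some (s * theta_iter (size v) t, PCWord a1 (v ++ b2))
          | right _ => None
          end
      end
  | _, _ => None
  end.

Lemma theta_iterS n s : theta_iter n.+1 s = val (theta (theta_iter n s)).
Proof. by []. Qed.

Lemma theta_iterM n : {morph theta_iter n : s t / s * t}.
Proof.
move=> s t; elim: n => [//|n IHn].
by rewrite !theta_iterS IHn gmulfM.
Qed.

Lemma theta_iterD m n s :
  theta_iter (m + n) s = theta_iter m (theta_iter n s).
Proof. exact: iterD. Qed.

Lemma bruck_reilly_mull s a1 a2 t u b2 :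
  bruck_reilly_mul (Some (s, PCWord a1 a2)) (Some (t, PCWord (u ++ a2) b2)) =
  Some (theta_iter (size u) s * t, PCWord (u ++ a1) b2).
Proof.
rewrite /bruck_reilly_mul; case: pselect => [e|[]]; last by exists u.
by case: (cid e) => w /= /cat_injr <-.
Qed.

Lemma bruck_reilly_mulr s a1 v t b1 b2 :
  bruck_reilly_mul (Some (s, PCWord a1 (v ++ b1))) (Some (t, PCWord b1 b2)) =
  Some (s * theta_iter (size v) t, PCWord a1 (v ++ b2)).
Proof.
rewrite /bruck_reilly_mul; case: pselect => [e|_].
  case: (cid e) => w /= e1; have /eqP := congr1 size e1.
  rewrite !size_cat addnA -{1}(add0n (size b1)) eqn_add2r eq_sym addn_eq0.
  by case/andP=> /nilP -> /nilP ->.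
case: pselect => [e|[]]; last by exists v.
by case: (cid e) => w /= /cat_injr <-.
Qed.

Lemma bruck_reilly_mul0 s a1 a2 t b1 b2 : ~ word_comparable a2 b1 ->
  bruck_reilly_mul (Some (s, PCWord a1 a2)) (Some (t, PCWord b1 b2)) = None.
Proof.
move=> n; rewrite /bruck_reilly_mul.
case: pselect => [e|_]; first by case: n; left.
by case: pselect => [e|_] //; case: n; right.
Qed.

Lemma bruck_reilly_mulA : associative bruck_reilly_mul.
Proof.
have mul_None x : bruck_reilly_mul x None = None by case: x => [[? []]|].
move=> [[s [a1 a2]]|//] [[t [b1 b2]]|//] [[r [c1 c2]]|]; last first.
  by rewrite !mul_None.
case: (pselect (word_comparable a2 b1)) => [[[u ->]|[v ->]]|n1];
  case: (pselect (word_comparable b2 c1)) => [[[w ->]|[w ->]]|n2].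
- rewrite !bruck_reilly_mull (catA w u a2) bruck_reilly_mull.
  by rewrite size_cat theta_iterD theta_iterM mulgA catA.
- by rewrite bruck_reilly_mull !bruck_reilly_mulr bruck_reilly_mull mulgA.
- by rewrite bruck_reilly_mull !bruck_reilly_mul0.
- rewrite bruck_reilly_mull bruck_reilly_mulr.
  case: (pselect (word_comparable v w)) => [[[k ->]|[k ->]]|n].
  + rewrite -!catA !bruck_reilly_mull size_cat.
    by rewrite theta_iterM mulgA theta_iterD.
  + rewrite -!catA !bruck_reilly_mulr size_cat.
    by rewrite theta_iterM mulgA theta_iterD.
  + by rewrite !bruck_reilly_mul0 // => /word_comparable_cat2r.
- rewrite !bruck_reilly_mulr (catA v w c1) bruck_reilly_mulr.
  by rewrite size_cat theta_iterD theta_iterM mulgA catA.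
- rewrite bruck_reilly_mulr !bruck_reilly_mul0 //.
  by move/word_comparable_catl.
- rewrite bruck_reilly_mull !bruck_reilly_mul0 //.
  by move/word_comparableC/word_comparable_catl/word_comparableC.
- by rewrite bruck_reilly_mulr !bruck_reilly_mul0.
- by rewrite !bruck_reilly_mul0.
Qed.

HB.instance Definition _ := gen_eqMixin bruck_reilly.
HB.instance Definition _ := gen_choiceMixin bruck_reilly.
HB.instance Definition _ :=
  isSemigroup.Build bruck_reilly bruck_reilly_mulA.

End BruckReilly.

(* Main.v *)
Require Import Defs.
From mathcomp Require Import all_boot.
From mathcomp Require Import boolp.

(** An inverse of [(s, a^{-1} b)] is necessarily of the form [(t, b^{-1} a)]:
    comparing the outer words in [x y x = x] and [y x y = y] forces every word
    [u], [v] occurring in the products to be empty.  Hence no power of [theta]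
    survives, and the inverses of [(s, a^{-1} b)] correspond to those of [s]. *)

Set Implicit Arguments.
Unset Strict Implicit.
Unset Printing Implicit Defensive.

Local Open Scope group_scope.

Definition mutually_inverse (T : semigroupType) (x y : T) : Prop :=
  x * y * x = x /\ y * x * y = y.

Lemma cat_eqr (T : Type) (u a : seq T) : u ++ a = a -> u = [::].
Proof. exact: (@cat_injr _ u [::] a). Qed.

Section BruckReillyInverses.
Variables (lambda : Type) (S : monoidType).
Variable theta : {multiplicative S -> unit_group S}.
Implicit Types (s t : S) (a b c d : seq lambda).
Implicit Types x y : bruck_reilly lambda theta.

(** A bare [Some] does not determine [theta]; fixing the type lets [*] be inferred. *)
Definition br_elt s a b : bruck_reilly lambda theta := Some (s, PCWord a b).

Definition br_zero : bruck_reilly lambda theta := None.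

Lemma br_mulr0 x : x * br_zero = br_zero.
Proof. by case: x => [[? []]|]. Qed.

Lemma br_mull s t a1 a2 u b2 :
  br_elt s a1 a2 * br_elt t (u ++ a2) b2 =
  br_elt (theta_iter theta (size u) s * t) (u ++ a1) b2.
Proof. exact: bruck_reilly_mull. Qed.

Lemma br_mulr s t a1 v b1 b2 :
  br_elt s a1 (v ++ b1) * br_elt t b1 b2 =
  br_elt (s * theta_iter theta (size v) t) a1 (v ++ b2).
Proof. exact: bruck_reilly_mulr. Qed.

Lemma br_mul_eq0 s t a1 a2 b1 b2 : ~ word_comparable a2 b1 ->
  br_elt s a1 a2 * br_elt t b1 b2 = br_zero.
Proof. exact: bruck_reilly_mul0. Qed.

Lemma br_mul_diag s t a b c :
  br_elt s a b * br_elt t b c = br_elt (s * t) a c.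
(* With [u] empty, [theta_iter theta 0] and the concatenations compute away. *)
Proof. exact: (br_mull s t a b [::] c). Qed.

Lemma br_zero_inverse y : mutually_inverse br_zero y <-> y = br_zero.
Proof.
by split=> [[_]|->//]; rewrite br_mulr0.
Qed.

Lemma br_elt_inverse s t a b :
  mutually_inverse (br_elt s a b) (br_elt t b a) <-> mutually_inverse s t.
Proof.
rewrite /mutually_inverse !br_mul_diag.
by split=> [[[->] [->]]|[-> ->]].
Qed.

(** If [a = u ++ d], the left words give [u ++ a = a]; if [d = v ++ a], the right words give
    [v ++ b = b]; otherwise the product is zero. *)
Lemma br_mul_fixr s t r a b d :
  br_elt s a d * br_elt t a b = br_elt r a b -> d = a.
Proof.
have [[[u ->]|[v ->]]|n] := pselect (word_comparable d a).
- by rewrite br_mull => -[_ /cat_eqr ->].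
- by rewrite br_mulr => -[_ /cat_eqr ->].
- by rewrite br_mul_eq0.
Qed.

(** Applied to [x * y * x = x], this makes the left word of [x * y] a suffix of that of [x]. *)
Lemma br_mul_suffixl s t r a1 a2 b1 b2 e f :
  br_elt s a1 a2 * br_elt t b1 b2 = br_elt r e f -> exists w, e = w ++ a1.
Proof.
have [[[u ->]|[v ->]]|n] := pselect (word_comparable a2 b1).
- by rewrite br_mull => -[_ <- _]; exists u.
- by rewrite br_mulr => -[_ <- _]; exists [::].
- by rewrite br_mul_eq0.
Qed.

Lemma br_inverse_words s t a b c d :
  mutually_inverse (br_elt s a b) (br_elt t c d) -> c = b /\ d = a.
Proof.
case; have [[[u ->]|[v ->]]|n] := pselect (word_comparable b c).
(* The left word of [x * y] is [u ++ a], so [a = w ++ u ++ a] and [u] is empty; [x * y * x = x]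
   alone suffices here. *)
- rewrite br_mull => xyx _; have [w] := br_mul_suffixl xyx.
  rewrite catA => /esym/cat_eqr; case: w => [|//] /= u0.
  by rewrite u0 /= in xyx *; rewrite (br_mul_fixr xyx).
(* The first equation only yields [a = v ++ d]; then [y * x * y] has left word [v ++ c], and
   comparison with [c] empties [v]. *)
- rewrite br_mulr => /br_mul_fixr <-.
  by rewrite br_mull br_mulr => -[_ /cat_eqr ->].
- by rewrite br_mul_eq0.
Qed.

Lemma br_inverseP s a b y :
  mutually_inverse (br_elt s a b) y <->
  exists2 t, y = br_elt t b a & mutually_inverse s t.
Proof.
split=> [|[t -> st]]; last exact: (br_elt_inverse s t a b).2.
case: y => [[t [c d]]|] xy; last by case: xy => /=; rewrite br_mulr0.
have [cb da] := br_inverse_words xy.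
by rewrite cb da in xy *; exists t => //; exact: (br_elt_inverse s t a b).1 xy.
Qed.

End BruckReillyInverses.

Theorem mainTheorem6 (lambda : Type) (S : monoidType)
    (theta : {multiplicative S -> unit_group S}) :
  inhabited lambda ->
  inverse_semigroup (bruck_reilly lambda theta) <-> inverse_semigroup S.
Proof.
move=> _; split=> [invBR s|invS].
  (* [S] embeds as the nonzero elements with both words empty, and inverses stay in this copy. *)
  have [y [/br_inverseP [t -> st] uniq_y]] := invBR (br_elt theta s [::] [::]).
  exists t; split=> // t' st'.
  by have [] := uniq_y _ ((br_elt_inverse theta s t' [::] [::]).2 st').
case=> [[s [a b]]|]; last first.
  exists (br_zero lambda theta); split=> [|y]; first exact/br_zero_inverse.
  by move/br_zero_inverse.
have [t [st uniq_t]] := invS s.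
exists (br_elt theta t b a); split=> [|y].
  exact: (br_elt_inverse theta s t a b).2.
(* The words of an inverse are forced, so uniqueness reduces to that in [S]. *)
by case/br_inverseP=> t' -> /uniq_t ->.
Qed.
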